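(* Let $X,Y\in B(\mathcal K)_{\mathrm{sa}}$, let $V:\mathcal H\to\mathcal K$ be an isometry, and put $$P=VV^*,\qquad A=(I-P)XV,\qquad B=(I-P)YV.$$ Then $((X,Y),V)$ is a $\Gamma_J$-pair, where $\Gamma_J(x,y)=(x,y,xy+yx)$, if and only if $$A^*B+B^*A=0.$$ For $\Gamma_{xy}(x,y)=\big(x,y,xy+yx,i(xy-yx)\big)$, the corresponding condition (characterizing $\Gamma_{xy}$-pairs) is $A^*B=0$.
   Context: $\mathcal H,\mathcal K$ are Hilbert spaces and $B(\mathcal K)_{\mathrm{sa}}$ denotes the bounded self-adjoint operators. For a tuple $\Gamma$ of self-adjoint free polynomials in $(x,y)$, $((X,Y),V)$ is a $\Gamma$-pair if $V^*\Gamma(X,Y)V=\Gamma(V^*XV,V^*YV)$, where $V^*(\cdot)V$ acts coordinatewise. *)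

(* Defs.v *)
From HB Require Import structures.
From mathcomp Require Export all_boot all_order all_algebra.
From mathcomp Require Export sesquilinear finmap complex.
(* monalg has to be imported before the analysis files: in the other order its
   notations fail to parse. These files are exported to fix that order. *)
From mathcomp Require Export monalg.
From mathcomp Require Export boolp classical_sets functions reals topology.
From mathcomp Require Export normedtype.
From mathcomp Require Import ring lra.

Set Implicit Arguments.
Unset Strict Implicit.
Unset Printing Implicit Defensive.

Import Order.TTheory GRing.Theory Num.Theory.
Import numFieldNormedType.Exports.

Local Open Scope classical_set_scope.
Local Open Scope ring_scope.

(* Complex Hilbert spaces. The form is linear in its first argument and
   conjugate linear in its second one ({dot _ for _} of sesquilinear.v), and
   norms are valued in R[i], as for any normed module over R[i]. *)
HB.mixin Record CompleteNormedModule_isHilbert (R : realType) (H : Type)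
    & CompleteNormedModule R[i] H := {
  hdot : {dot H for (@Num.conj_op R[i])} ;
  hdotxx : forall x : H, hdot x x = `|x| ^+ 2
}.

#[short(type="hilbertType")]
HB.structure Definition Hilbert (R : realType) :=
  {H of CompleteNormedModule R[i] H & CompleteNormedModule_isHilbert R H}.

Section HilbertTheory.
Context {R : realType} {H : hilbertType R}.
Implicit Types x y z : H.

Lemma hdotC x y : hdot y x = (hdot x y)^*.
Proof. by rewrite hermC/= expr0 mul1r. Qed.

Lemma hdot_normD x y :
  `|x + y| ^+ 2 = `|x| ^+ 2 + `|y| ^+ 2 + (hdot x y + (hdot x y)^*).
Proof. by rewrite -!hdotxx dnormD. Qed.

Lemma hdot_inj x y : (forall z, hdot z x = hdot z y) -> x = y.
Proof.
move=> xy; apply/eqP; rewrite -subr_eq0 -normr_eq0 -sqrf_eq0 -hdotxx.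
by rewrite linearBr/= xy subrr.
Qed.

Lemma hdot_CauchySchwarz x y : `|hdot x y| <= `|x| * `|y|.
Proof.
have [->|y0] := eqVneq y 0; first by rewrite linear0r !normr0 mulr0.
set c := hdot x y; have [n nD] : {n : R[i] | n = `|y| ^+ 2} by exists (`|y| ^+ 2).
have n0 : 0 < n by rewrite nD exprn_gt0// normr_gt0.
have nE : n^* = n by rewrite conj_Creal// gtr0_real.
have cE : (`|c| ^+ 2)^* = `|c| ^+ 2 by rewrite conj_Creal// rpredX// normr_real.
have : 0 <= hdot (n *: x - c *: y) (n *: x - c *: y) by rewrite dnorm_ge0.
rewrite dnormB !dnormZ linearZl_LR linearZr_LR/= !hdotxx -nD -/c.
rewrite (mulrC _ c) -normCK rmorphM/= nE cE (gtr0_norm n0).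
rewrite [X in 0 <= X](_ : _ = n * ((`|x| * `|y|) ^+ 2 - `|c| ^+ 2)); last first.
  by rewrite exprMn -nD; ring.
by rewrite pmulr_rge0// subr_ge0 ler_sqr ?nnegrE ?mulr_ge0.
Qed.
End HilbertTheory.

Section Riesz.
Context {R : realType} {H : hilbertType R}.
Local Notation Re := complex.Re.

Local Lemma ReD (a b : R[i]) : Re (a + b) = Re a + Re b.
Proof. by case: a b => [? ?] []. Qed.
Local Lemma ReN (a : R[i]) : Re (- a) = - Re a.
Proof. by case: a. Qed.
Local Lemma ReCM (a : R) (b : R[i]) : Re (a%:C%C * b) = a * Re b.
Proof. by case: b => c d /=; rewrite mul0r subr0. Qed.
Local Lemma ge0_ReE (a : R[i]) : 0 <= a -> a = (Re a)%:C%C.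
Proof. by case: a => a b; rewrite lecE/= => /andP[/eqP -> _]. Qed.
Local Lemma le_Re (a b : R[i]) : a <= b -> Re a <= Re b.
Proof. by case: a b => [a a'] [b b']; rewrite lecE/= => /andP[]. Qed.
Local Lemma Re_le_norm (a : R[i]) : Re a <= Re `|a|.
Proof.
have := normc_ge_Re a; rewrite (ge0_ReE (normr_ge0 a)) lecR.
exact/le_trans/ler_norm.
Qed.

Theorem riesz (f : H -> R[i]) : scalar f ->
  (exists M : R[i], forall x, `|f x| <= M * `|x|) ->
  exists z, forall x, f x = hdot x z.
Proof.
move=> fl [M fM].
have fD x y : f (x + y) = f x + f y by rewrite -[x]scale1r fl mul1r scale1r.
have f0 : f 0 = 0 by apply: (addrI (f 0)); rewrite -fD !addr0.
have fZ a x : f (a *: x) = a * f x by rewrite -[a *: x]addr0 fl f0 addr0.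
have fN x : f (- x) = - f x by rewrite -scaleN1r fZ mulN1r.
pose N (x : H) : R := Re `|x|.
have NE x : `|x| = (N x)%:C%C by by rewrite /N -ge0_ReE.
have N0 x : 0 <= N x by have := le_Re (normr_ge0 x).
have NZ (a : R) x : N (a%:C%C *: x) = `|a| * N x.
  rewrite {1}/N normrZ normc_def/= expr0n addr0 sqrtr_sqr. by rewrite ReCM.
have NN x : N (- x) = N x by rewrite /N normrN.
pose J x := N x ^+ 2 - 2 * Re (f x).
have JD x w : J (x + w) = J x + 2 * Re (hdot w x - f w) + N w ^+ 2.
  rewrite /J fD !ReD ReN.
  have -> : N (x + w) ^+ 2 = N x ^+ 2 + N w ^+ 2 + 2 * Re (hdot w x).
    apply: complexI; rewrite rmorphXn/= -NE hdot_normD hdotC.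
    rewrite !rmorphD/= !rmorphXn/= -!NE; congr (_ + _).
    by rewrite rmorphM/= conjCK; case: (hdot w x) => a b; simpc;
      apply/eqP; rewrite eq_complex/=; apply/andP; split; apply/eqP; ring.
  by ring.
have Jge x : - (Re M) ^+ 2 <= J x.
  have : Re (f x) <= Re M * N x.
    apply: (le_trans (Re_le_norm _)); rewrite (le_trans (le_Re (fM x)))//.
    by rewrite NE mulrC ReCM mulrC.
  by rewrite /J; have := sqr_ge0 (N x - Re M); nra.
have hasinf : has_inf (range J).
  split; first by exists (J 0), 0.
  by exists (- (Re M) ^+ 2) => _ [x _ <-].
pose d := inf (range J).
have dJ x : d <= J x by apply: ge_inf; [case: hasinf|exists x].
have Jd e : 0 < e -> exists x, J x < d + e.
  by move=> e0; have [_ [x _ <-] Jx] := inf_adherent e0 hasinf; exists x.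
have JB e x y : J x < d + e -> J y < d + e -> N (x - y) ^+ 2 <= 4 * e.
  move=> Jx Jy; pose h : R[i] := (2^-1)%:C%C.
  have hh : h + h = 1 by rewrite -rmorphD/= (_ : 2^-1 + 2^-1 = 1 :> R)//; lra.
  pose m := h *: (x + y); pose u := h *: (x - y).
  have xE : x = m + u.
    by rewrite -scalerDr addrACA subrr addr0 scalerDr -scalerDl hh scale1r.
  have yE : y = m - u.
    by rewrite -scalerBr opprB [x + y + _]addrC addrA subrK scalerDr -scalerDl hh scale1r.
  have Nu : N u = 2^-1 * N (x - y) by rewrite /u /h NZ ger0_norm// invr_ge0 ler0n.
  have := JD m u; have := JD m (- u); rewrite -xE -yE linearNl/= fN NN.
  rewrite !ReD !ReN; have := dJ m; nra.
have /choice[a aJ] : forall n : nat, exists x, J x < d + n.+1%:R^-1.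
  by move=> n; apply: Jd; rewrite invr_gt0.
have small (e : R) : 0 < e -> exists n : nat, 4 * n.+1%:R^-1 < e.
  move=> e0; exists (Num.truncn (4 / e)).
  by rewrite ltr_pdivrMr// -ltr_pdivrMl// mulrC truncnS_gt.
have aB n k : (n <= k)%N -> N (a n - a k) ^+ 2 <= 4 * n.+1%:R^-1.
  move=> nk; apply: JB (aJ n) _; apply: (lt_le_trans (aJ k)).
  by rewrite lerD2l lef_pV2 ?posrE// ler_nat.
have acvg : cvg (a @ \oo).
  apply/cauchy_cvgP/cauchy_exP => e e0; have eE := ge0_ReE (ltW e0).
  have e0' : 0 < Re e by rewrite eE ltcR in e0.
  have [n ne] := small (Re e ^+ 2) (exprn_gt0 _ e0'); exists (a n).
  exists n => // k /= nk; rewrite -ball_normE/= NE eE ltcR.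
  rewrite -(@ltr_pXn2r _ 2) ?nnegrE//; last exact: ltW.
  exact: le_lt_trans (aB _ _ nk) ne.
set z := lim (a @ \oo).
exists z => h; apply/eqP; rewrite eq_sym -subr_eq0 -normr_eq0.
pose g w := hdot w z - f w.
have gge w : 0 <= 2 * Re (g w) + N w ^+ 2.
  rewrite leNgt; apply/negP; set D := (X in X < 0) => D0.
  have ND0 : 0 < - D by rewrite oppr_gt0.
  have [n nD] := small (- D) ND0.
  pose c := - D / (4 * (N w + 1)).
  have c0 : 0 < c by rewrite divr_gt0 ?oppr_gt0// mulr_gt0// ltr_wpDl.
  have c0' : 0 < c%:C%C :> R[i] by rewrite ltcR.
  have /cvgrPdist_lt /(_ _ c0') [p _ pP] := acvg.
  pose q := maxn n p.
  have := pP q (leq_maxr _ _); rewrite /= -/z NE ltcR => zq.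
  have qn : (q.+1%:R^-1 : R) <= n.+1%:R^-1.
    by rewrite lef_pV2 ?posrE// ler_nat ltnS leq_maxl.
  have := JD (a q) w; have := dJ (a q + w); have := aJ q.
  have : Re (hdot w (a q)) <= Re (hdot w z) + N w * N (z - a q).
    rewrite -lerBlDl -ReN -ReD -linearBr/= (le_trans (Re_le_norm _))//.
    rewrite -[N (z - _)]NN opprB.
    have := le_Re (hdot_CauchySchwarz w (a q - z)).
    by rewrite NE ReCM.
  have : N w * N (z - a q) <= - D / 4.
    have cw : c * (N w + 1) = - D / 4.
      by rewrite /c invfM mulrA -mulrA mulVf ?mulr1// gt_eqF// ltr_wpDl.
    by rewrite -cw; have := N0 (z - a q); have := N0 w; nra.
  have DE : D = 2 * (Re (hdot w z) - Re (f w)) + N w ^+ 2.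
    by rewrite /D /g ReD ReN.
  rewrite ReD ReN; move: DE D0 nD qn. clear -D. clearbody D.
  move: (Re (hdot w (a q))) (Re (hdot w z)) (Re (f w)) (J (a q)) (J (a q + w)).
  move: (N w * N (z - a q)) (N w ^+ 2) d D (n.+1%:R^-1) (q.+1%:R^-1).
  clear; move=> ? ? ? D0 ? ? ? ? ? ? ? ? ? ? ? ? ? ? ? ?; lra.
have gZ b w : g (b *: w) = b * g w by rewrite /g linearZl_LR fZ mulrBr.
pose r := N h ^+ 2; have r0 : 0 <= r by rewrite sqr_ge0.
pose t := (1 + r)^-1.
have t0 : 0 < t by rewrite invr_gt0 ltr_wpDr.
pose s := Re `|g h|.
have gE : `|g h| = s%:C%C by rewrite [LHS]ge0_ReE.
have := gge ((- t)%:C%C * (g h)^* *: h).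
rewrite gZ -mulrA [_^* * _]mulrC -normCK gE.
rewrite {1}/N normrZ normrM norm_conjC gE.
have -> : (- t)%:C%C * s%:C%C ^+ 2 = (- t * s ^+ 2)%:C%C :> R[i].
  by rewrite rmorphM rmorphXn.
have -> : `|(- t)%:C%C| * s%:C%C * `|h| = (t * s * N h)%:C%C :> R[i].
  by rewrite NE normc_def/= expr0n addr0 sqrtr_sqr normrN gtr0_norm// !rmorphM.
rewrite /= !exprMn -/r => sr.
rewrite eq_complex/= eqxx andbT -sqrf_eq0 eq_le sqr_ge0 andbT leNgt.
apply/negP => s0.
have tr : t * r < 1 by rewrite mulrC ltr_pdivrMr ?ltr_wpDr// mul1r ltrDr.
have : t ^+ 2 * (s ^+ 2 * r) = t * s ^+ 2 * (t * r) by ring.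
have : 0 < t * s ^+ 2 by rewrite mulr_gt0.
by move: sr; clear -tr; nra.
Qed.
End Riesz.

Section Bop.
Context {R : realType}.
Implicit Types H K L : hilbertType R.

Record bop H K := Bop {
  bop_fun :> H -> K;
  bop_linear : linear bop_fun;
  bop_bounded : exists M : R[i], forall x, `|bop_fun x| <= M * `|x|
}.

HB.instance Definition _ H K := gen_eqMixin (bop H K).
HB.instance Definition _ H K := gen_choiceMixin (bop H K).
HB.instance Definition _ H K (T : bop H K) :=
  GRing.isLinear.Build R[i] H K *:%R (bop_fun T) (@bop_linear H K T).

Lemma bopP H K (S T : bop H K) : S =1 T <-> S = T.
Proof.
split=> [|->//]; case: S T => [f fl fb] [g gl gb] /= /funext fg.
by case: g / fg gl gb => gl gb; congr Bop; exact: Prop_irrelevance.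
Qed.

Lemma bop_boundedW H K (T : bop H K) :
  exists2 M : R[i], 0 <= M & forall x, `|T x| <= M * `|x|.
Proof.
have [M TM] := bop_bounded T; exists `|M| => // x.
have MTx : 0 <= M * `|x| := le_trans (normr_ge0 _) (TM x).
by rewrite -(normr_id x) -normrM (ger0_norm MTx).
Qed.

Section Module.
Variables H K : hilbertType R.

Fact bop0_linear : linear (fun _ : H => 0 : K).
Proof. by move=> a x y; rewrite scaler0 addr0. Qed.
Fact bop0_bounded : exists M : R[i], forall x : H, `|0 : K| <= M * `|x|.
Proof. by exists 0 => x; rewrite normr0 mul0r. Qed.
Definition bop0 := Bop bop0_linear bop0_bounded.

Fact bopN_linear (T : bop H K) : linear (fun x => - T x).
Proof. by move=> a x y; rewrite linearP opprD scalerN. Qed.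
Fact bopN_bounded (T : bop H K) :
  exists M : R[i], forall x, `|- T x| <= M * `|x|.
Proof. by have [M TM] := bop_bounded T; exists M => x; rewrite normrN. Qed.
Definition bopN (T : bop H K) := Bop (bopN_linear T) (@bopN_bounded T).

Fact bopD_linear (S T : bop H K) : linear (fun x => S x + T x).
Proof. by move=> a x y; rewrite !linearP addrACA scalerDr. Qed.
Fact bopD_bounded (S T : bop H K) :
  exists M : R[i], forall x, `|S x + T x| <= M * `|x|.
Proof.
have [M SM] := bop_bounded S; have [N TN] := bop_bounded T.
by exists (M + N) => x; rewrite mulrDl (le_trans (ler_normD _ _))// lerD.
Qed.
Definition bopD (S T : bop H K) := Bop (bopD_linear S T) (bopD_bounded S T).

Fact bopZ_linear (a : R[i]) (T : bop H K) : linear (fun x => a *: T x).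
Proof. by move=> b x y; rewrite linearP scalerDr !scalerA mulrC. Qed.
Fact bopZ_bounded (a : R[i]) (T : bop H K) :
  exists M : R[i], forall x, `|a *: T x| <= M * `|x|.
Proof.
have [M TM] := bop_bounded T.
by exists (`|a| * M) => x; rewrite normrZ -mulrA ler_wpM2l.
Qed.
Definition bopZ (a : R[i]) (T : bop H K) :=
  Bop (bopZ_linear a T) (bopZ_bounded a T).

Fact bop_addA : associative bopD.
Proof. by move=> S T U; apply/bopP => x /=; rewrite addrA. Qed.
Fact bop_addC : commutative bopD.
Proof. by move=> S T; apply/bopP => x /=; rewrite addrC. Qed.
Fact bop_add0 : left_id bop0 bopD.
Proof. by move=> S; apply/bopP => x /=; rewrite add0r. Qed.
Fact bop_addN : left_inverse bop0 bopN bopD.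
Proof. by move=> S; apply/bopP => x /=; rewrite addNr. Qed.
HB.instance Definition _ :=
  GRing.isZmodule.Build (bop H K) bop_addA bop_addC bop_add0 bop_addN.

Fact bop_scaleA a b T : bopZ a (bopZ b T) = bopZ (a * b) T.
Proof. by apply/bopP => x /=; rewrite scalerA. Qed.
Fact bop_scale1 : left_id 1 bopZ.
Proof. by move=> T; apply/bopP => x /=; rewrite scale1r. Qed.
Fact bop_scaleDr : right_distributive bopZ +%R.
Proof. by move=> a S T; apply/bopP => x /=; rewrite scalerDr. Qed.
Fact bop_scaleDl T : {morph bopZ^~ T : a b / a + b}.
Proof. by move=> a b; apply/bopP => x /=; rewrite scalerDl. Qed.
HB.instance Definition _ := GRing.Zmodule_isLmodule.Build R[i] (bop H K)
  bop_scaleA bop_scale1 bop_scaleDr bop_scaleDl.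

Lemma bop0E x : (0 : bop H K) x = 0. Proof. by []. Qed.
Lemma bopNE (T : bop H K) x : (- T) x = - T x. Proof. by []. Qed.
Lemma bopDE (S T : bop H K) x : (S + T) x = S x + T x. Proof. by []. Qed.
Lemma bopZE a (T : bop H K) x : (a *: T) x = a *: T x. Proof. by []. Qed.

End Module.

Fact bop1_linear H : linear (@idfun H). Proof. by []. Qed.
Fact bop1_bounded H : exists M : R[i], forall x : H, `|idfun x| <= M * `|x|.
Proof. by exists 1 => x; rewrite mul1r. Qed.
Definition bop1 H : bop H H := Bop (@bop1_linear H) (@bop1_bounded H).

Fact bop_comp_linear H K L (S : bop K L) (T : bop H K) : linear (S \o T).
Proof. by move=> a x y /=; rewrite !linearP. Qed.
Fact bop_comp_bounded H K L (S : bop K L) (T : bop H K) :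
  exists M : R[i], forall x, `|(S \o T) x| <= M * `|x|.
Proof.
have [M M0 SM] := bop_boundedW S; have [N TN] := bop_bounded T.
exists (M * N) => x; rewrite -mulrA (le_trans (SM _))//.
exact: ler_wpM2l (TN x).
Qed.
Definition bop_comp H K L (S : bop K L) (T : bop H K) : bop H L :=
  Bop (bop_comp_linear S T) (bop_comp_bounded S T).

Definition is_adjoint H K (T : bop H K) (S : bop K H) :=
  forall x y, hdot (T x) y = hdot x (S y).

Lemma is_adjoint_uniq H K (T : bop H K) (S S' : bop K H) :
  is_adjoint T S -> is_adjoint T S' -> S = S'.
Proof.
by move=> TS TS'; apply/bopP => y; apply: hdot_inj => x; rewrite -TS -TS'.
Qed.

Lemma adjoint_exists H K (T : bop H K) : exists S : bop K H, is_adjoint T S.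
Proof.
have [M M0 TM] := bop_boundedW T.
have /choice[S TS] : forall y, exists z, forall x, hdot (T x) y = hdot x z.
  move=> y; apply: (riesz (f := fun x => hdot (T x) y)).
    by move=> a u v; rewrite linearP linearPl.
  exists (M * `|y|) => x; rewrite (le_trans (hdot_CauchySchwarz _ _))//.
  by rewrite mulrAC ler_wpM2r.
have Sl : linear S.
  by move=> a u v; apply: hdot_inj => x; rewrite -TS !linearPr/= !TS.
have Sb : exists M : R[i], forall y, `|S y| <= M * `|y|.
  exists M => y; have [->|Sy0] := eqVneq (S y) 0.
    by rewrite normr0 mulr_ge0.
  rewrite -(@ler_pM2r _ `|S y|) ?normr_gt0// -expr2 -hdotxx -TS.
  rewrite -[X in X <= _]ger0_norm; last by rewrite TS dnorm_ge0.
  rewrite (le_trans (hdot_CauchySchwarz _ _))// mulrAC ler_wpM2r//.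
by exists (Bop Sl Sb) => x y; exact: TS.
Qed.

(* is_adjoint_uniq makes the choice immaterial. *)
Definition adjoint H K (T : bop H K) : bop K H := sval (cid (adjoint_exists T)).

Lemma adjointP H K (T : bop H K) : is_adjoint T (adjoint T).
Proof. exact: (svalP (cid (adjoint_exists T))). Qed.

Definition selfadjoint H (T : bop H H) := adjoint T = T.

Definition bop_isometry H K (V : bop H K) := forall x, `|V x| = `|x|.

End Bop.

Notation "''B' ( H , K )" := (bop H K) (format "''B' ( H ,  K )") : type_scope.
Notation "''B' ( H )" := (bop H H) (format "''B' ( H )") : type_scope.
Notation "\1o" := (bop1 _) : ring_scope.
Notation "S *o T" := (bop_comp S T) (at level 40, left associativity) : ring_scope.
Notation "T ^*o" := (adjoint T) (at level 2, format "T ^*o") : ring_scope.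

Section FreePolynomials.
Variable R : realType.

Definition fpoly := {malg R[i][{fmonom 'I_2}]}.

Definition word_rev (m : {fmonom 'I_2}) : {fmonom 'I_2} := FMonom (rev m).

(* The involution: antilinear, word-reversing, and fixing x and y *)
Definition fpstar (p : fpoly) : fpoly :=
  \sum_(m <- msupp p) << (p@_m)^* *g word_rev m >>.

Definition fpvar (i : 'I_2) : fpoly := << fmu i >>.
Definition fpx : fpoly := fpvar 0.
Definition fpy : fpoly := fpvar 1.

Lemma word_revK : involutive word_rev.
Proof. by case=> s; rewrite /word_rev/= revK. Qed.

Lemma mcoeff_fpstar p m : (fpstar p)@_m = (p@_(word_rev m))^*.
Proof.
rewrite /fpstar raddf_sum/=; under eq_bigr do rewrite mcoeffU.
have [mp|mp] := boolP (word_rev m \in msupp p); last first.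
  rewrite (mcoeff_outdom mp) rmorph0 big_seq big1// => k kp.
  by case: eqP => // km; rewrite -km word_revK kp in mp.
rewrite (big_fsetD1 _ mp)/= word_revK eqxx mulr1n big_seq big1 ?addr0// => k.
rewrite in_fsetD1 => /andP[/eqP km _]; case: eqP => // kE.
by case: km; rewrite -kE word_revK.
Qed.

Lemma fpstarD p q : fpstar (p + q) = fpstar p + fpstar q.
Proof. by apply/malgP => m; rewrite mcoeffD !mcoeff_fpstar mcoeffD rmorphD. Qed.

Lemma fpstarB p q : fpstar (p - q) = fpstar p - fpstar q.
Proof. by apply/malgP => m; rewrite mcoeffB !mcoeff_fpstar mcoeffB rmorphB. Qed.

Lemma fpstarZ c p : fpstar (c *: p) = c^* *: fpstar p.
Proof. by apply/malgP => m; rewrite mcoeffZ !mcoeff_fpstar mcoeffZ rmorphM. Qed.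

Lemma fpstarU m : fpstar << m >> = << word_rev m >>.
Proof.
apply/malgP => k; rewrite mcoeff_fpstar !mcoeffU1 rmorph_nat.
by rewrite -(inj_eq (inv_inj word_revK)) word_revK.
Qed.

Lemma fpvarM i j : fpvar i * fpvar j = << FMonom [:: i; j] >>.
Proof.
rewrite /fpvar malgM_def fgmulUU mul1r !fmuE.
by congr << _ >>; rewrite /mul/= fmmulE.
Qed.

Lemma fpstar_var i : fpstar (fpvar i) = fpvar i.
Proof. by rewrite /fpvar fpstarU fmuE. Qed.

Lemma fpstar_varM i j : fpstar (fpvar i * fpvar j) = fpvar j * fpvar i.
Proof. by rewrite !fpvarM fpstarU. Qed.

Record safpoly := SAFPoly {
  safpoly_val :> fpoly;
  safpolyP : fpstar safpoly_val = safpoly_val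
}.

Lemma fpstar_jordan p q : fpstar (p * q) = q * p -> fpstar (q * p) = p * q ->
  fpstar (p * q + q * p) = p * q + q * p.
Proof. by move=> pq qp; rewrite fpstarD addrC; exact: (congr2 +%R qp pq). Qed.

Lemma fpstar_comm p q : fpstar (p * q) = q * p -> fpstar (q * p) = p * q ->
  fpstar ('i *: (p * q - q * p)) = 'i *: (p * q - q * p).
Proof.
move=> pq qp; rewrite fpstarZ conjCi fpstarB.
transitivity (- 'i *: (q * p - p * q)).
  exact: (congr2 (fun a b => - 'i *: (a - b)) pq qp).
by rewrite scaleNr -scalerN opprB.
Qed.

Definition sax := SAFPoly (fpstar_var 0).
Definition say := SAFPoly (fpstar_var 1).
Definition sajordan : safpoly := @SAFPoly (fpx * fpy + fpy * fpx)
  (fpstar_jordan (fpstar_varM 0 1) (fpstar_varM 1 0)).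
Definition sacomm : safpoly := @SAFPoly ('i *: (fpx * fpy - fpy * fpx))
  (fpstar_comm (fpstar_varM 0 1) (fpstar_varM 1 0)).

Definition GammaJ : 3.-tuple safpoly := [tuple sax; say; sajordan].
Definition Gammaxy : 4.-tuple safpoly := [tuple sax; say; sajordan; sacomm].

End FreePolynomials.

Section GammaPair.
Context {R : realType}.
Implicit Types H K : hilbertType R.

Definition word_eval H (Z : 2.-tuple 'B(H)) (m : {fmonom 'I_2}) : 'B(H) :=
  \big[@bop_comp R H H H/bop1 H]_(i <- (m : seq 'I_2)) tnth Z i.

Definition fpoly_eval H (Z : 2.-tuple 'B(H)) (p : fpoly R) : 'B(H) :=
  \sum_(m <- msupp p) p@_m *: word_eval Z m.

Definition tuple_eval n (Gamma : n.-tuple (safpoly R)) H (Z : 2.-tuple 'B(H)) :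
  n.-tuple 'B(H) :=
  [tuple of [seq fpoly_eval Z p | p : safpoly R <- Gamma]].

Definition compress n H K (V : 'B(H, K)) (Z : n.-tuple 'B(K)) :
  n.-tuple 'B(H) :=
  [tuple of [seq V^*o *o T *o V | T <- Z]].

Definition is_Gamma_pair n (Gamma : n.-tuple (safpoly R)) H K
    (X Y : 'B(K)) (V : 'B(H, K)) :=
  compress V (tuple_eval Gamma [tuple X; Y]) =
  tuple_eval Gamma (compress V [tuple X; Y]).

End GammaPair.

(* Main.v *)
From HB Require Import structures.
Require Import Defs.

Set Implicit Arguments.
Unset Strict Implicit.
Unset Printing Implicit Defensive.

Import Order.TTheory GRing.Theory Num.Theory.
Import numFieldNormedType.Exports.

Local Open Scope ring_scope.

(** Write S' = V^*SV for the compression of S to H, and call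
    V^*(ST)V - S'T' the multiplicative defect of the pair (S, T).

    Evaluation of a free polynomial is linear in the polynomial, and
    compression is linear in the operator. The coordinates x and y of a tuple
    are therefore always compatible with compression, while the coordinates
    xy + yx and i(xy - yx) are compatible exactly when the defects d(X, Y) and
    d(Y, X) satisfy d(X, Y) + d(Y, X) = 0, respectively d(X, Y) = d(Y, X).
    The last two equations together say that both defects vanish.

    The link with A and B is [mult_defectE]. As V is an isometry, V^*V = 1, so
    P = VV^* is a self-adjoint idempotent and so is 1 - P. For self-adjoint X,
    A^*B = V^*X(1 - P)YV = V^*XYV - (V^*XV)(V^*YV), which is d(X, Y); likewise
    B^*A = d(Y, X). Finally B^*A = (A^*B)^*, so that A^*B = 0 alone forces both
    defects to vanish. *)

(** * Composition, adjoints and isometries *)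

Section OperatorAlgebra.
Context {R : realType}.
Implicit Types H K L M : hilbertType R.

Lemma bop_compA H K L M (S : 'B(L, M)) (T : 'B(K, L)) (U : 'B(H, K)) :
  S *o T *o U = S *o (T *o U).
Proof. by apply/bopP. Qed.

Lemma bop_comp1o H K (T : 'B(H, K)) : \1o *o T = T.
Proof. by apply/bopP. Qed.

Lemma bop_compo1 H K (T : 'B(H, K)) : T *o \1o = T.
Proof. by apply/bopP. Qed.

Lemma bop_compDl H K L (S T : 'B(K, L)) (U : 'B(H, K)) :
  (S + T) *o U = S *o U + T *o U.
Proof. by apply/bopP. Qed.

Lemma bop_compBl H K L (S T : 'B(K, L)) (U : 'B(H, K)) :
  (S - T) *o U = S *o U - T *o U.
Proof. by apply/bopP. Qed.

Lemma bop_compZl H K L a (S : 'B(K, L)) (U : 'B(H, K)) :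
  (a *: S) *o U = a *: (S *o U).
Proof. by apply/bopP. Qed.

Lemma bop_compDr H K L (S : 'B(K, L)) (T U : 'B(H, K)) :
  S *o (T + U) = S *o T + S *o U.
Proof. by apply/bopP => x /=; rewrite linearD. Qed.

Lemma bop_compBr H K L (S : 'B(K, L)) (T U : 'B(H, K)) :
  S *o (T - U) = S *o T - S *o U.
Proof. by apply/bopP => x /=; rewrite linearB. Qed.

Lemma bop_compZr H K L a (S : 'B(K, L)) (T : 'B(H, K)) :
  S *o (a *: T) = a *: (S *o T).
Proof. by apply/bopP => x /=; rewrite linearZ. Qed.

Lemma adjoint_eq H K (T : 'B(H, K)) (S : 'B(K, H)) : is_adjoint T S -> T^*o = S.
Proof. exact/is_adjoint_uniq/adjointP. Qed.

Lemma adjointK H K (T : 'B(H, K)) : T^*o^*o = T.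
Proof.
by apply: adjoint_eq => x y; rewrite hdotC -adjointP -hdotC.
Qed.

Lemma adjoint0 H K : (0 : 'B(H, K))^*o = 0.
Proof. by apply: adjoint_eq => x y; rewrite linear0l linear0r. Qed.

Lemma adjoint1 H : (\1o : 'B(H))^*o = \1o.
Proof. by apply: adjoint_eq. Qed.

Lemma adjointB H K (S T : 'B(H, K)) : (S - T)^*o = S^*o - T^*o.
Proof.
by apply: adjoint_eq => x y; rewrite /= linearBl linearBr/= !adjointP.
Qed.

Lemma adjoint_comp H K L (S : 'B(K, L)) (T : 'B(H, K)) :
  (S *o T)^*o = T^*o *o S^*o.
Proof. by apply: adjoint_eq => x y /=; rewrite !adjointP. Qed.

(** Polarization: preservation of norms controls only the real part of the form,
    and the imaginary part is recovered from the pair ('i *: x, y). *)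
Lemma isometry_hdot H K (V : 'B(H, K)) x y :
  bop_isometry V -> hdot (V x) (V y) = hdot x y.
Proof.
move=> hV.
have twice_re u v : hdot (V u) (V v) + (hdot (V u) (V v))^* =
    hdot u v + (hdot u v)^*.
  have := hdot_normD (V u) (V v).
  by rewrite -linearD !hV hdot_normD => /addrI.
have := twice_re ('i *: x) y; rewrite linearZ/= !linearZl_LR/=.
rewrite !rmorphM/= !conjCi !mulNr -!mulrBr => /(mulfI (neq0Ci _)) im.
have := congr2 +%R (twice_re x y) im.
rewrite [LHS]addrACA [RHS]addrACA !subrr !addr0.
by rewrite -!mulr2n => /eqP; rewrite eqrMn2r// => /eqP.
Qed.

Lemma isometry_adjointK H K (V : 'B(H, K)) :
  bop_isometry V -> V^*o *o V = \1o.
Proof.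
move=> hV; apply/bopP => y /=; apply: hdot_inj => x.
by rewrite -adjointP isometry_hdot.
Qed.

End OperatorAlgebra.

(** * Evaluation of free polynomials *)

Section Evaluation.
Context {R : realType} {H : hilbertType R} (Z : 2.-tuple 'B(H)).
Implicit Types p q : fpoly R.

(** The support of a sum depends on cancellations; linearity is checked on a set
    that contains the supports of all the polynomials involved. *)
Lemma fpoly_evalw (D : {fset {fmonom 'I_2}}) (p : fpoly R) :
  (msupp p `<=` D)%fset -> fpoly_eval Z p = \sum_(m <- D) p@_m *: word_eval Z m.
Proof.
move=> pD; apply: big_fset_incl => // m _ mp.
by rewrite mcoeff_outdom// scale0r.
Qed.

Lemma fpoly_eval_linear : linear (fpoly_eval Z).
Proof.
move=> a p q; pose D := (msupp p `|` msupp q `|` msupp (a *: p + q))%fset.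
have pD : (msupp p `<=` D)%fset by rewrite /D -fsetUA fsubsetUl.
have qD : (msupp q `<=` D)%fset by rewrite /D fsetUAC fsubsetUr.
rewrite !(@fpoly_evalw D) ?fsubsetUr// scaler_sumr -big_split/=.
by apply: eq_bigr => m _; rewrite mcoeffD mcoeffZ scalerDl scalerA.
Qed.

HB.instance Definition _ :=
  GRing.isLinear.Build R[i] (fpoly R) 'B(H) *:%R (fpoly_eval Z)
    fpoly_eval_linear.

Lemma fpoly_evalD p q : fpoly_eval Z (p + q) = fpoly_eval Z p + fpoly_eval Z q.
Proof. exact: linearD. Qed.

Lemma fpoly_evalB p q : fpoly_eval Z (p - q) = fpoly_eval Z p - fpoly_eval Z q.
Proof. exact: linearB. Qed.

Lemma fpoly_evalZ a p : fpoly_eval Z (a *: p) = a *: fpoly_eval Z p.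
Proof. exact: linearZ. Qed.

Lemma fpoly_evalU m : fpoly_eval Z << m >> = word_eval Z m.
Proof.
rewrite (@fpoly_evalw [fset m]%fset) ?msuppU_le//.
by rewrite big_seq_fset1 mcoeffUU scale1r.
Qed.

Lemma fpoly_eval_var i : fpoly_eval Z (fpvar R i) = tnth Z i.
Proof. by rewrite fpoly_evalU /word_eval fmuE big_cons big_nil bop_compo1. Qed.

Lemma fpoly_eval_varM i j :
  fpoly_eval Z (fpvar R i * fpvar R j) = tnth Z i *o tnth Z j.
Proof.
by rewrite fpvarM fpoly_evalU /word_eval !big_cons big_nil bop_compo1.
Qed.

End Evaluation.

Section EvaluationOnPairs.
Context {R : realType} {H : hilbertType R}.

Lemma fpoly_eval_jordan (S T : 'B(H)) :
  fpoly_eval [tuple S; T] (sajordan R) = S *o T + T *o S.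
Proof.
(* Each product is rewritten alone: matching xy against yx would make
   unification unfold the multiplication of polynomials. *)
by rewrite fpoly_evalD; congr (_ + _); rewrite fpoly_eval_varM.
Qed.

Lemma fpoly_eval_comm (S T : 'B(H)) :
  fpoly_eval [tuple S; T] (sacomm R) = 'i *: (S *o T - T *o S).
Proof.
rewrite fpoly_evalZ fpoly_evalB; congr (_ *: (_ - _)).
  by rewrite fpoly_eval_varM.
by rewrite fpoly_eval_varM.
Qed.

End EvaluationOnPairs.

(** * Compressions and their multiplicative defect *)

Section GammaPairs.
Context {R : realType} {H K : hilbertType R}.
Implicit Types (S T : 'B(K)) (V : 'B(H, K)).

Definition compression V S : 'B(H) := V^*o *o S *o V.

Definition mult_defect V S T : 'B(H) :=
  compression V (S *o T) - compression V S *o compression V T.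

Lemma compressionD V S T :
  compression V (S + T) = compression V S + compression V T.
Proof. by rewrite /compression bop_compDr bop_compDl. Qed.

Lemma compressionB V S T :
  compression V (S - T) = compression V S - compression V T.
Proof. by rewrite /compression bop_compBr bop_compBl. Qed.

Lemma compressionZ V a S : compression V (a *: S) = a *: compression V S.
Proof. by rewrite /compression bop_compZr bop_compZl. Qed.

(** With P = VV^*, the second term V^*SVV^*TV of the defect is V^*SPTV, so the
    defect is V^*S(1 - P)TV; since 1 - P is a self-adjoint idempotent, it splits
    into the adjoint of (1 - P)SV times (1 - P)TV. *)
Lemma mult_defectE V S T : selfadjoint S -> bop_isometry V ->
  mult_defect V S T = ((\1o - V *o V^*o) *o S *o V)^*o *o
                      ((\1o - V *o V^*o) *o T *o V).
Proof.
move=> hS hV; set Q := \1o - V *o V^*o.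
have QQ : Q *o Q = Q.
  rewrite {2}/Q bop_compBr bop_compo1 {2}/Q bop_compBl bop_comp1o.
  rewrite bop_compA -(bop_compA V^*o) isometry_adjointK// bop_comp1o.
  by rewrite subrr subr0.
have Qadj : Q^*o = Q.
  by rewrite /Q adjointB adjoint1 adjoint_comp adjointK.
rewrite !adjoint_comp Qadj hS !bop_compA -(bop_compA Q) QQ.
rewrite /Q !(bop_compBl, bop_compBr) bop_comp1o.
by rewrite /mult_defect /compression !bop_compA.
Qed.

Lemma Gamma_pairP n (Gamma : n.-tuple (safpoly R)) X Y V :
  is_Gamma_pair Gamma X Y V <-> forall i,
    compression V (fpoly_eval [tuple X; Y] (tnth Gamma i)) =
    fpoly_eval [tuple compression V X; compression V Y] (tnth Gamma i).
Proof.
have cE : compress V [tuple X; Y] = [tuple compression V X; compression V Y].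
  exact: val_inj.
rewrite /is_Gamma_pair cE; split=> [pr i|pr].
  by have := congr1 (fun t => tnth t i) pr; rewrite !tnth_map.
by apply: eq_from_tnth => i; rewrite !tnth_map -pr.
Qed.

Lemma jordan_compressionP X Y V :
  (compression V (fpoly_eval [tuple X; Y] (sajordan R)) =
   fpoly_eval [tuple compression V X; compression V Y] (sajordan R)) <->
  mult_defect V X Y + mult_defect V Y X = 0.
Proof.
rewrite !fpoly_eval_jordan compressionD /mult_defect addrACA -opprD.
by split=> /eqP; rewrite ?subr_eq0 => /eqP // ->; rewrite subrr.
Qed.

Lemma comm_compressionP X Y V :
  (compression V (fpoly_eval [tuple X; Y] (sacomm R)) =
   fpoly_eval [tuple compression V X; compression V Y] (sacomm R)) <->
  mult_defect V X Y = mult_defect V Y X.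
Proof.
rewrite !fpoly_eval_comm compressionZ compressionB /mult_defect.
set a := compression V _; set b := compression V _.
set c := _ *o _; set d := _ *o _.
have abcd : (a - b) - (c - d) = (a - c) - (b - d).
  by rewrite !opprB addrACA [RHS]addrACA [- c - b]addrC.
split=> [/(scalerI (neq0Ci _)) ab|/eqP].
  by apply/eqP; rewrite -subr_eq0 -abcd ab subrr.
by rewrite -subr_eq0 -abcd subr_eq0 => /eqP ->.
Qed.

(** Only the Jordan coordinate carries a condition: evaluation at x
    and y returns the operators, so their coordinates agree for every V. *)
Lemma GammaJ_pairP X Y V : is_Gamma_pair (GammaJ R) X Y V <->
  mult_defect V X Y + mult_defect V Y X = 0.
Proof.
rewrite -jordan_compressionP Gamma_pairP.
split=> [/(_ (Ordinal (isT : 2 < 3)%N))|J]; first by rewrite (tnth_nth (sax R)).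
by case=> [[|[|[|i]]] hi] //; rewrite (tnth_nth (sax R))//= !fpoly_eval_var.
Qed.

(** The Jordan coordinate kills the symmetric part of the defect and the
    commutator coordinate its antisymmetric part. *)
Lemma Gammaxy_pairP X Y V : is_Gamma_pair (Gammaxy R) X Y V <->
  mult_defect V X Y = 0 /\ mult_defect V Y X = 0.
Proof.
have -> : is_Gamma_pair (Gammaxy R) X Y V <->
    mult_defect V X Y + mult_defect V Y X = 0 /\
    mult_defect V X Y = mult_defect V Y X.
  rewrite -jordan_compressionP -comm_compressionP Gamma_pairP.
  split=> [pr|[J C]].
    have := pr (Ordinal (isT : 2 < 4)%N); have := pr (Ordinal (isT : 3 < 4)%N).
    by rewrite !(tnth_nth (sax R)).
  case=> [[|[|[|[|i]]]] hi] //; rewrite (tnth_nth (sax R))//=.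
    by rewrite !fpoly_eval_var.
  by rewrite !fpoly_eval_var.
split=> [[+ XY]|[-> ->]]; last by rewrite addr0.
rewrite XY -mulr2n -scaler_nat => /eqP.
by rewrite scaler_eq0 pnatr_eq0/= => /eqP.
Qed.

End GammaPairs.

Theorem proposition9p1 (R : realType) (H K : hilbertType R) (X Y : 'B(K))
    (V : 'B(H, K)) (hX : selfadjoint X) (hY : selfadjoint Y)
    (hV : bop_isometry V) :
  let P : 'B(K) := V *o V^*o in
  let A : 'B(H, K) := (\1o - P) *o X *o V in
  let B : 'B(H, K) := (\1o - P) *o Y *o V in
  (is_Gamma_pair (GammaJ R) X Y V <-> A^*o *o B + B^*o *o A = 0) /\
  (is_Gamma_pair (Gammaxy R) X Y V <-> A^*o *o B = 0).
Proof.
move=> P A B; rewrite GammaJ_pairP Gammaxy_pairP !mult_defectE// -/P -/A -/B.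
split=> //; split=> [[]//|AB]; split=> //.
(* The remaining defect B^*A is the adjoint of A^*B. *)
by rewrite -[A]adjointK -adjoint_comp AB adjoint0.
Qed.
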